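(* Let $\ell,n,\Delta\in\mathbb{N}^+$. Then every deterministic $(\ell,n,\Delta)$-Static Ranker requires at least $$\mathcal{B}=\left\lfloor \frac{n}{\lceil \Delta/\ell\rceil}\right\rfloor\cdot\log_2\!\Big(\max\big\{\lfloor \ell/\Delta\rfloor,1\big\}+1\Big)$$ bits of memory.
   Context: For a value $V$ and $\epsilon>0$, $\widehat V$ is an $\epsilon$-additive approximation of $V$ if $V-\epsilon<\widehat V\le V$. For $\ell,n,\Delta\in\mathbb{N}^+$, an $(\ell,n,\Delta)$-Static Ranker is a data structure that preprocesses a sequence $x=(x_1,\dots,x_n)\in\{0,1,\dots,\ell\}^n$ and, when queried with any $i\le n$, returns (in $O(1)$ time, word RAM with word size $\Theta(\log n+\log\ell)$) a $\Delta$-additive approximation of $S_i=\sum_{d=1}^i x_d$. Its memory is the number of bits of the structure stored after preprocessing (on which the answers to queries depend). *)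

(* Defs.v *)
From HB Require Import structures.
From mathcomp Require Import all_boot all_order all_algebra.
From mathcomp Require Import reals exp.

Set Implicit Arguments.
Unset Strict Implicit.
Unset Printing Implicit Defensive.

Import Order.TTheory GRing.Theory Num.Theory.
Local Open Scope ring_scope.

Definition additive_approx (R : realType) (eps V V' : R) : Prop :=
  V - eps < V' /\ V' <= V.

(* S_i = x_1 + ... + x_i; as indices start at 0 here, x_d is [tnth x (d - 1)]. *)
Definition prefix_sum (l n : nat) (x : n.-tuple 'I_l.+1) (i : nat) : nat :=
  (\sum_(d < n | d < i) tnth x d)%N.

(* A deterministic (l, n, Delta)-static ranker: preprocessing stores a block of
   [memory] bits, and queries see only these bits and the index. Query time is
   left out: for fixed l, n and Delta, O(1) time excludes no query function, so
   quantifying over this type covers every O(1)-time word-RAM ranker. Answers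
   may be arbitrary reals. *)
Record static_ranker (R : realType) (l n Delta : nat) : Type := StaticRanker {
  memory : nat;
  preprocess : n.-tuple 'I_l.+1 -> memory.-tuple bool;
  query : memory.-tuple bool -> nat -> R;
  queryP : forall (x : n.-tuple 'I_l.+1) (i : nat), (i <= n)%N ->
    additive_approx (Delta%:R) ((prefix_sum x i)%:R) (query (preprocess x) i)
}.

Definition log2 (R : realType) (x : R) : R := ln x / ln 2.

(* Main.v *)
Require Import Defs.
From mathcomp Require Import all_boot all_order all_algebra.
From mathcomp Require Import reals exp.
From mathcomp Require Import zify lra.

(** Put [c = ceil (Delta / l)] and [m = max (floor (l / Delta)) 1], and cut the
    sequence into [n %/ c] blocks of length [c]. A word with one letter in
    [{0, .., m}] per block is encoded by filling the block of a letter [a] with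
    the constant [v * a], where [v = minn l Delta]. This multiplies prefix sums
    by [c * v >= Delta], and no real is a [Delta]-additive approximation of two
    numbers that are [Delta] apart, so two words stored as the same bits have
    the same prefix sums and are equal. Hence
    [(m + 1) ^ (n %/ c) <= 2 ^ memory]. *)

Set Implicit Arguments.
Unset Strict Implicit.
Unset Printing Implicit Defensive.

Import Order.TTheory GRing.Theory Num.Theory.
Local Open Scope ring_scope.

Lemma leq_divn_mul (j a b : nat) : (j <= a %/ b)%N -> (j * b <= a)%N.
Proof.
by move=> le_j; rewrite (leq_trans _ (leq_divM a b)) // leq_mul2r le_j orbT.
Qed.

Definition ceil_divn (a b : nat) : nat := ((a + b.-1) %/ b)%N.

Lemma ceil_divn_gt0 (a b : nat) :
  (0 < a)%N -> (0 < b)%N -> (0 < ceil_divn a b)%N.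
Proof. by move=> a_gt0 b_gt0; rewrite divn_gt0 //; lia. Qed.

Lemma leq_ceil_divnM (a b : nat) : (0 < b)%N -> (a <= ceil_divn a b * b)%N.
Proof.
by move=> b_gt0; rewrite /ceil_divn; have := ltn_ceil (a + b.-1) b_gt0; lia.
Qed.

Lemma ltn_ceil_divnMD (a b : nat) :
  (0 < b)%N -> (ceil_divn a b * b < a + b)%N.
Proof.
by move=> b_gt0; rewrite /ceil_divn; have := leq_divM (a + b.-1) b; lia.
Qed.

Lemma ceil_natr_div (F : archiNumFieldType) (a b : nat) : (0 < b)%N ->
  Num.ceil (a%:R / b%:R : F) = (ceil_divn a b)%:Z.
Proof.
move=> b_gt0; apply: ceil_def; have b_gt0F : (0 : F) < b%:R by rewrite ltr0n.
rewrite intrD mulrN1z -pmulrn ltrBlDr ler_pdivrMr // -natrM ler_nat.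
rewrite leq_ceil_divnM // andbT -(ltr_pM2r b_gt0F) mulrDl divfK ?lt0r_neq0 //.
by rewrite mul1r -natrM -natrD ltr_nat ltn_ceil_divnMD.
Qed.

Lemma floor_natr_div (F : archiNumFieldType) (a b : nat) : (0 < b)%N ->
  Num.floor (a%:R / b%:R : F) = (a %/ b)%:Z.
Proof.
move=> b_gt0; apply: floor_def; have b_gt0F : (0 : F) < b%:R by rewrite ltr0n.
rewrite intrD -pmulrn ler_pdivlMr // ltr_pdivrMr // natr1 -!natrM.
by rewrite ler_nat ltr_nat leq_divM ltn_ceil.
Qed.

Lemma minn_mul_maxn_divn (a b : nat) : (minn a b * maxn (a %/ b) 1 <= a)%N.
Proof.
have [->|b_gt0] := posnP b; first by rewrite minn0.
by have := leq_divM a b; rewrite /minn /maxn; case: ifP; case: ifP; nia.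
Qed.

Lemma natr_mul_log2_le (R : realType) (x : R) (k M : nat) : 0 < x ->
  (k%:R * log2 x <= M%:R) = (x ^+ k <= 2 ^+ M).
Proof.
move=> x_gt0; have ln2_gt0 : 0 < ln 2 :> R by rewrite ln_gt0 // ltr1n.
rewrite /log2 mulrA ler_pdivrMr // !mulr_natl -!lnXn //.
by rewrite ler_ln // posrE exprn_gt0.
Qed.

Lemma additive_approx_dist_lt (R : realType) (e V W a : R) :
  additive_approx e V a -> additive_approx e W a -> `|V - W| < e.
Proof. by move=> [Va aV] [Wa aW]; rewrite ltr_norml; lra. Qed.

Section PrefixSum.
Variables (l n : nat).
Implicit Types x y : n.-tuple 'I_l.+1.

Lemma prefix_sumE x (i : nat) : (i <= n)%N ->
  prefix_sum x i = (\sum_(0 <= d < i) nth ord0 x d)%N.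
Proof.
move=> le_in; rewrite (big_nat_widen _ _ _ _ _ le_in) big_mkord.
by apply: eq_bigr => d _; rewrite (tnth_nth ord0).
Qed.

Lemma prefix_sumS x (d : 'I_n) :
  prefix_sum x d.+1 = (prefix_sum x d + tnth x d)%N.
Proof.
by rewrite !prefix_sumE ?(ltnW (ltn_ord d)) // big_nat_recr //= (tnth_nth ord0).
Qed.

Lemma prefix_sum_inj x y :
  (forall i, (i <= n)%N -> prefix_sum x i = prefix_sum y i) -> x = y.
Proof.
move=> eq_xy; apply: eq_from_tnth => d; have := prefix_sumS x d.
by rewrite !eq_xy ?(ltnW (ltn_ord d)) // prefix_sumS => /addnI /val_inj.
Qed.

End PrefixSum.

Section StaticRanker.
Variables (R : realType) (l n Delta : nat) (A : static_ranker R l n Delta).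

Lemma preprocess_eq_dist_lt (x y : n.-tuple 'I_l.+1) (i : nat) :
    preprocess A x = preprocess A y -> (i <= n)%N ->
  (`|prefix_sum x i - prefix_sum y i| < Delta)%N.
Proof.
move=> eq_xy le_in; have Ay := queryP A y le_in; rewrite -eq_xy in Ay.
have := additive_approx_dist_lt (queryP A x le_in) Ay.
by rewrite !pmulrn -rmorphB -intr_norm ltr_int -abszE.
Qed.

Lemma card_code_le_memory (T : finType) (code : T -> n.-tuple 'I_l.+1) :
    (forall s t, (forall i, (i <= n)%N ->
       `|prefix_sum (code s) i - prefix_sum (code t) i| < Delta)%N -> s = t) ->
  (#|T| <= 2 ^ memory A)%N.
Proof.
move=> code_separated.
have stored_inj : injective (preprocess A \o code).
  move=> s t eq_st; apply: code_separated => i.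
  exact: preprocess_eq_dist_lt.
by have := leq_card _ stored_inj; rewrite card_tuple card_bool.
Qed.

End StaticRanker.

Section BlockCode.
Variables (l n c v m : nat).
Hypothesis vm_le_l : (v * m <= l)%N.
Implicit Types s t : (n %/ c).-tuple 'I_m.+1.

Definition block_code s : n.-tuple 'I_l.+1 :=
  [tuple inord (v * nth ord0 s (d %/ c)) | d < n].

Lemma nth_block_code s (d : nat) : (d < n)%N ->
  nth ord0 (block_code s) d = (v * nth ord0 s (d %/ c))%N :> nat.
Proof.
move=> lt_dn; rewrite -(tnth_nth _ _ (Ordinal lt_dn)) tnth_mktuple inordK //=.
by rewrite ltnS (leq_trans _ vm_le_l) // leq_mul2l -ltnS ltn_ord orbT.
Qed.

Lemma prefix_sum_block_code s (j : nat) : (j <= n %/ c)%N ->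
  prefix_sum (block_code s) (j * c) = (c * v * prefix_sum s j)%N.
Proof.
move=> le_j; have le_jc := leq_divn_mul le_j.
rewrite !prefix_sumE // big_nat_mul big_distrr /=; apply: eq_big_nat => k lt_kj.
rewrite (@eq_big_nat _ _ _ _ _ _ (fun=> v * nth ord0 s k)%N).
  by rewrite sum_nat_const_nat mulSn addnK mulnA.
move=> d lt_d; rewrite nth_block_code; last by nia.
by rewrite (_ : d %/ c = k)%N //; nia.
Qed.

Lemma expn_block_code_le_memory (R : realType) (Delta : nat)
    (A : static_ranker R l n Delta) :
  (Delta <= c * v)%N -> (m.+1 ^ (n %/ c) <= 2 ^ memory A)%N.
Proof.
move=> Delta_le.
have <- : #|{: (n %/ c).-tuple 'I_m.+1}| = (m.+1 ^ (n %/ c))%N.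
  by rewrite card_tuple card_ord.
apply: (card_code_le_memory A (code := block_code)) => s t close_st.
apply: prefix_sum_inj => j le_j.
have := close_st _ (leq_divn_mul le_j).
by rewrite !prefix_sum_block_code //; nia.
Qed.

End BlockCode.

Theorem theorem2 (R : realType) (l n Delta : nat)
    (hl : (0 < l)%N) (hn : (0 < n)%N) (hDelta : (0 < Delta)%N)
    (A : static_ranker R l n Delta) :
  (Num.floor ((n%:R : R) / (Num.ceil ((Delta%:R : R) / l%:R))%:~R))%:~R
    * log2 ((Num.max (Num.floor ((l%:R : R) / Delta%:R)) 1)%:~R + 1)
  <= ((memory A)%:R : R).
Proof.
pose c := ceil_divn Delta l; pose v := minn l Delta.
have c_gt0 : (0 < c)%N by exact: ceil_divn_gt0.
have Delta_le_cv : (Delta <= c * v)%N.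
  by rewrite /v minnE; have := leq_ceil_divnM Delta hl; rewrite -/c; nia.
rewrite ceil_natr_div // !floor_natr_div // -/c.
have -> : Num.max (l %/ Delta)%:Z 1 = (maxn (l %/ Delta) 1)%:Z by lia.
rewrite -!pmulrn natr1 natr_mul_log2_le ?ltr0n // -!natrX ler_nat.
have vm_le_l := minn_mul_maxn_divn l Delta.
exact: (expn_block_code_le_memory vm_le_l A Delta_le_cv).
Qed.
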